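(* Let $f:\mathbb{H}\to\mathbb{H}$, $f(x)=axb$, and $g:\mathbb{H}\to\mathbb{H}$, $g(x)=cxd$, be two simple rotations. Let $y,z,u,w\in\mathbb{H}$ be unit quaternions such that $f$ is the composition of the reflection $R_y$ followed by the reflection $R_z$, i.e. $f=R_z\circ R_y$ (with $a=z\bar y$, $b=\bar y z$), and $g$ is the composition of the reflection $R_u$ followed by the reflection $R_w$, i.e. $g=R_w\circ R_u$ (with $c=w\bar u$, $d=\bar u w$). Then the composition $g\circ f$ is a simple rotation if and only if the four normals $y,z,u,w$ of the reflections are linearly dependent over $\mathbb{R}$ (as vectors of $\mathbb{H}\cong\mathbb{R}^4$).
   Context: $\mathbb{H}$ is the algebra of real quaternions $x=x_0+x_1i+x_2j+x_3k$, identified with Euclidean space $\mathbb{E}^4=\mathbb{R}^4$ with its standard scalar product. Write $Sx=x_0$ (real part), $Vx=x_1i+x_2j+x_3k$ (vector part), $\bar x=Sx-Vx$ (conjugate), $Nx=x\bar x=x_0^2+x_1^2+x_2^2+x_3^2$. A unit quaternion is one with $Nx=1$. For a unit quaternion $y$, $R_y(x)=-y\bar x y$ is the reflection of $\mathbb{E}^4$ in the hyperplane through the origin having $y$ as its normal. A simple rotation is a rotation of $\mathbb{E}^4$ in a plane (2-dimensional linear subspace) through some angle $\alpha$ such that all points of the orthogonal plane remain fixed; in quaternionic form, it is a map $x\mapsto axb$ with $Na=Nb=1$ and $Sa=Sb=\cos\frac{\alpha}{2}$ (the identity, with $\alpha=0$, is included). Every simple rotation can be written as $x\mapsto axb=(z\bar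 y)x(\bar y z)=R_z(R_y(x))$ for some unit quaternions $y,z$ with $a=z\bar y$ and $b=\bar y z$. *)

(* Defs.v *)
From HB Require Import structures.
From mathcomp Require Import all_boot all_order all_algebra.
From mathcomp Require Import all_classical all_reals all_analysis.

Set Implicit Arguments.
Unset Strict Implicit.
Unset Printing Implicit Defensive.

Import GRing.Theory Num.Theory.
Local Open Scope ring_scope.

(* The quaternion x0 + x1 i + x2 j + x3 k is the row vector (x0, x1, x2, x3),
   so that the algebra of quaternions is R^4 itself, and linear dependence over
   R is the negation of the predicate [free] on 'rV[R]_4. *)
Notation quaternion R := 'rV[R]_4.

Section Quaternion.
Variable R : realType.
Implicit Types x y z e : quaternion R.

Definition quat (s p q r : R) : quaternion R := \row_i [:: s; p; q; r]`_i.

(* Hamilton's product: i^2 = j^2 = k^2 = ijk = -1. *)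
Definition qmul x y : quaternion R := quat
  (x 0 0 * y 0 0 - x 0 1 * y 0 1 - x 0 2 * y 0 2 - x 0 3 * y 0 3)
  (x 0 0 * y 0 1 + x 0 1 * y 0 0 + x 0 2 * y 0 3 - x 0 3 * y 0 2)
  (x 0 0 * y 0 2 - x 0 1 * y 0 3 + x 0 2 * y 0 0 + x 0 3 * y 0 1)
  (x 0 0 * y 0 3 + x 0 1 * y 0 2 - x 0 2 * y 0 1 + x 0 3 * y 0 0).

Definition qconj x : quaternion R := quat (x 0 0) (- x 0 1) (- x 0 2) (- x 0 3).

Definition qdot x y : R := \sum_i x 0 i * y 0 i.

(* The norm N x = x * qconj x, without square root. *)
Definition qnorm x : R := \sum_i x 0 i ^+ 2.

(* For a unit y, the reflection in the hyperplane with normal y. *)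
Definition qrefl y x : quaternion R := - qmul (qmul y (qconj x)) y.

(* The rotation through alpha of the plane with orthonormal basis (e1, e2),
   fixing the orthogonal plane pointwise; alpha = 0 gives the identity. *)
Definition simple_rotation (f : quaternion R -> quaternion R) : Prop :=
  exists (alpha : R) e1 e2,
    [/\ qdot e1 e1 = 1, qdot e2 e2 = 1 & qdot e1 e2 = 0] /\
    [/\ linear f,
        f e1 = cos alpha *: e1 + sin alpha *: e2,
        f e2 = - sin alpha *: e1 + cos alpha *: e2 &
        forall x, qdot x e1 = 0 -> qdot x e2 = 0 -> f x = x].

End Quaternion.

(* Main.v *)
Require Import Defs.
From mathcomp Require Import all_boot all_order all_algebra.
From mathcomp Require Import all_classical all_reals all_analysis.
From mathcomp Require Import ring lra.
Set Implicit Arguments.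
Unset Strict Implicit.
Unset Printing Implicit Defensive.
Local Open Scope ring_scope.
Import Order.TTheory GRing.Theory Num.Theory.

(** The composition is the sandwich map x |-> p x q, where
    p = (w u^-)(z y^-) and q = (y^- z)(u^- w) are unit quaternions (x^- being
    the conjugate of x).  The theorem is the conjunction of two facts.

    A sandwich by unit quaternions is a simple rotation exactly when p and q
    have the same real part ([sandwich_simpleP]).  A simple rotation fixes a
    nonzero vector v (anything orthogonal to its plane), and p v q = v says that
    p is the conjugate by v of q^-, which forces Sp = Sq ([re_eq_of_fixed]).
    Conversely, unit quaternions with equal real parts are conjugate: p t = t q
    for some unit t ([intertwiner]).  Then p x q = (p (x t^-) p) t, so up to the
    isometry x |-> x t^- the map is x |-> p x p.  The latter is the identity if
    p is real; otherwise it rotates the plane spanned by 1 and p through twice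
    the argument of p, and it fixes the orthogonal plane, whose members are pure
    and satisfy p x = x p^- ([sandwich_simple]).

    The difference Sq - Sp is an alternating 4-linear form of (y, z, u, w),
    hence a multiple of their determinant, and the multiple is 2
    ([re_sub_det]).  It vanishes exactly when the four normals are linearly
    dependent ([free_det]). *)

(** * Determinants and linear independence *)

(** The entries are indexed by [nat] so that the indices produced by the
    repeated cofactor expansion compute to numerals. *)
Lemma det_quad (F : comPzRingType) (f : nat -> nat -> F) :
  let minor2 i j := f 2 i * f 3 j - f 2 j * f 3 i in
  let minor3 i j k :=
    f 1 i * minor2 j k - f 1 j * minor2 i k + f 1 k * minor2 i j in
  \det (\matrix_(i < 4, j < 4) f i j) =
    f 0 0 * minor3 1 2 3 - f 0 1 * minor3 0 2 3
    + f 0 2 * minor3 0 1 3 - f 0 3 * minor3 0 1 2.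
Proof.
move=> minor2 minor3; rewrite /minor3 /minor2.
do 3!rewrite ?(expand_det_row _ ord0) ?big_ord_recl ?big_ord0 /cofactor.
rewrite !det_mx11 !mxE /= /bump /=.
ring.
Qed.

Lemma free_det (F : fieldType) n (X : n.-tuple 'rV[F]_n) :
  free X = (\det (\matrix_(i < n) X`_i) != 0).
Proof.
have comb (k : 'rV[F]_n) :
    k *m \matrix_(i < n) X`_i = \sum_(i < n) k 0 i *: X`_i.
  by rewrite mulmx_sum_row; apply: eq_bigr => i _; rewrite rowK.
apply/freeP/idP => [freeX|detX k kX i].
  apply/det0P => -[k k0]; rewrite comb => /freeX kX.
  by case/eqP: k0; apply/rowP => i; rewrite kX mxE.
apply/eqP/negPn/negP => ki; case/det0P: detX; exists (\row_i k i).
  by apply: contraNneq ki => /rowP/(_ i); rewrite !mxE => ->.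
by rewrite comb -[RHS]kX; apply: eq_bigr => j _; rewrite mxE.
Qed.

(** * The algebra of quaternions *)

Section QuaternionAlgebra.
Context {R : realType}.
Implicit Types (x y z p q t v : quaternion R) (k : R).

Lemma ord4E (P : 'I_4 -> Prop) : P 0 -> P 1 -> P 2 -> P 3 -> forall i, P i.
Proof.
move=> P0 P1 P2 P3 [[|[|[|[|//]]]] lti].
- by rewrite (_ : Ordinal lti = 0) //; apply: val_inj.
- by rewrite (_ : Ordinal lti = 1) //; apply: val_inj.
- by rewrite (_ : Ordinal lti = 2) //; apply: val_inj.
- by rewrite (_ : Ordinal lti = 3) //; apply: val_inj.
Qed.

Lemma sum_ord4 (F : 'I_4 -> R) : \sum_i F i = F 0 + F 1 + F 2 + F 3.
Proof.
rewrite !big_ord_recl big_ord0 addr0 !addrA.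
by congr (F _ + F _ + F _ + F _); apply: val_inj.
Qed.

Lemma quat_eq x y : x 0 0 = y 0 0 -> x 0 1 = y 0 1 -> x 0 2 = y 0 2 ->
  x 0 3 = y 0 3 -> x = y.
Proof. by move=> *; apply/rowP; apply: ord4E. Qed.

Lemma qdotE x y :
  qdot x y = x 0 0 * y 0 0 + x 0 1 * y 0 1 + x 0 2 * y 0 2 + x 0 3 * y 0 3.
Proof. exact: sum_ord4. Qed.

Lemma qnormE x : qnorm x = x 0 0 ^+ 2 + x 0 1 ^+ 2 + x 0 2 ^+ 2 + x 0 3 ^+ 2.
Proof. exact: sum_ord4. Qed.

Definition qone : quaternion R := quat 1 0 0 0.

Ltac qring := apply: quat_eq; rewrite !mxE /=; ring.

Lemma qmulA x y z : qmul x (qmul y z) = qmul (qmul x y) z. Proof. qring. Qed.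
Lemma qmul1l x : qmul qone x = x. Proof. qring. Qed.
Lemma qmul1r x : qmul x qone = x. Proof. qring. Qed.
Lemma qmulDl x y z : qmul (x + y) z = qmul x z + qmul y z. Proof. qring. Qed.
Lemma qmulDr x y z : qmul x (y + z) = qmul x y + qmul x z. Proof. qring. Qed.
Lemma qmulZl k x y : qmul (k *: x) y = k *: qmul x y. Proof. qring. Qed.
Lemma qmulZr k x y : qmul x (k *: y) = k *: qmul x y. Proof. qring. Qed.
Lemma qconjM x y : qconj (qmul x y) = qmul (qconj y) (qconj x).
Proof. qring. Qed.
Lemma qmulxC x : qmul x (qconj x) = qnorm x *: qone.
Proof. rewrite qnormE; qring. Qed.
Lemma qmulCx x : qmul (qconj x) x = qnorm x *: qone.
Proof. rewrite qnormE; qring. Qed.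
Lemma qnormM x y : qnorm (qmul x y) = qnorm x * qnorm y.
Proof. rewrite !qnormE !mxE /=; ring. Qed.
Lemma qnorm_conj x : qnorm (qconj x) = qnorm x.
Proof. rewrite !qnormE !mxE /=; ring. Qed.
Lemma re_qmulC x y : qmul x y 0 0 = qmul y x 0 0.
Proof. rewrite !mxE /=; ring. Qed.
Lemma qdot_re x y : qdot x y = qmul x (qconj y) 0 0.
Proof. rewrite qdotE !mxE /=; ring. Qed.

(** Every quaternion is a root of its real quadratic characteristic polynomial. *)
Lemma qmulpp p : qmul p p = (2 * p 0 0) *: p - qnorm p *: qone.
Proof. rewrite qnormE; qring. Qed.

Lemma qnorm_eq0 x : (qnorm x == 0) = (x == 0).
Proof.
apply/eqP/eqP => [/psumr_eq0P nx|->]; last by rewrite qnormE !mxE; ring.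
by apply/rowP => i; apply/eqP; rewrite mxE -sqrf_eq0 nx // => j _; apply: sqr_ge0.
Qed.

Lemma unit_re_le1 p : qnorm p = 1 -> -1 <= p 0 0 <= 1.
Proof.
rewrite qnormE => np; rewrite -ler_norml -(@ler_pXn2r _ 2) ?nnegrE //.
rewrite expr1n real_normK ?num_real //.
by move: (sqr_ge0 (p 0 1)) (sqr_ge0 (p 0 2)) (sqr_ge0 (p 0 3)); lra.
Qed.

Lemma unit_real p : qnorm p = 1 -> p 0 0 ^+ 2 = 1 -> p = p 0 0 *: qone.
Proof.
rewrite qnormE => np p0.
have sqr0 (r : R) : 0 <= r ^+ 2 -> r ^+ 2 <= 0 -> r = 0.
  by move=> r1 r2; apply/eqP; rewrite -sqrf_eq0; apply/eqP/le_anti/andP.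
move: (sqr_ge0 (p 0 1)) (sqr_ge0 (p 0 2)) (sqr_ge0 (p 0 3)) => p1 p2 p3.
by apply: quat_eq; rewrite !mxE /= ?mulr1 ?mulr0 //; apply: sqr0 => //; lra.
Qed.

(** A pure quaternion orthogonal to the vector part of [p] anticommutes with that
    vector part; the hypotheses express both orthogonalities by real parts. *)
Lemma qmul_pure_perp p x : x 0 0 = 0 -> qmul x (qconj p) 0 0 = 0 ->
  qmul p x = qmul x (qconj p).
Proof.
move=> x0 px; have := px; rewrite !mxE /= x0 => px'.
by apply: quat_eq; rewrite !mxE /= x0; lra.
Qed.

(** * Sandwich maps and simple rotations *)

(** Two quaternions with the same real part and the same norm are conjugate.
    Their vector parts p', q' have equal squares, so T t = p' t + t q' satisfies
    p' (T t) = (T t) q' for every t, and only T t <> 0 has to be arranged.  If T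
    kills 1 then q' = - p' and T is the commutator with p'; if it also kills i
    and j then p' is central, hence 0, so that p = q is real and t = 1 will do. *)
Lemma intertwiner p q : p 0 0 = q 0 0 -> qnorm p = qnorm q ->
  exists2 t, qnorm t = 1 & qmul p t = qmul t q.
Proof.
move=> re_pq npq.
pose vec x : quaternion R := quat 0 (x 0 1) (x 0 2) (x 0 3).
pose T t := qmul (vec p) t + qmul t (vec q).
have pT t : qmul p (T t) = qmul (T t) q.
  have q0 : q 0 1 ^+ 2 + q 0 2 ^+ 2 + q 0 3 ^+ 2 =
            p 0 1 ^+ 2 + p 0 2 ^+ 2 + p 0 3 ^+ 2.
    by move: npq; rewrite !qnormE re_pq; lra.
  have vv x : qmul (vec x) (vec x) =
    - (x 0 1 ^+ 2 + x 0 2 ^+ 2 + x 0 3 ^+ 2) *: qone by qring.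
  have vE x : x = x 0 0 *: qone + vec x by qring.
  rewrite [p in LHS]vE [q in RHS]vE /T !(qmulDl, qmulDr) !qmulA vv.
  rewrite -[qmul (qmul t (vec q)) (vec q)]qmulA vv q0 re_pq.
  rewrite !(qmulZl, qmulZr, qmul1l, qmul1r).
  by rewrite addrACA [RHS]addrACA; congr (_ + _); rewrite addrC.
suff [t t_neq0 pt] : exists2 t, t != 0 & qmul p t = qmul t q.
  have nt : 0 < qnorm t.
    by rewrite lt_def qnorm_eq0 t_neq0 sumr_ge0 // => i _; apply: sqr_ge0.
  exists ((Num.sqrt (qnorm t))^-1 *: t); last by rewrite qmulZr qmulZl pt.
  rewrite qnormE !mxE !exprMn -!mulrDr -qnormE exprVn sqr_sqrtr ?ltW//.
  by rewrite mulVf // gt_eqF.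
have [T1|] := eqVneq (T qone) 0; last by exists (T qone).
have [Ti|] := eqVneq (T (quat 0 1 0 0)) 0; last by exists (T (quat 0 1 0 0)).
have [Tj|] := eqVneq (T (quat 0 0 1 0)) 0; last by exists (T (quat 0 0 1 0)).
exists qone; first by rewrite -qnorm_eq0 qnormE !mxE /=; apply/eqP; lra.
rewrite qmul1l qmul1r.
have c x i : x = 0 -> x 0 i = 0 by move=> ->; rewrite mxE.
move: (c _ 1 T1) (c _ 2 T1) (c _ 3 T1) (c _ 2 Ti) (c _ 3 Ti) (c _ 3 Tj).
by rewrite !mxE /= => *; apply: quat_eq => //; lra.
Qed.

Lemma exists_orthogonal x y : exists v, [/\ v != 0, qdot v x = 0 & qdot v y = 0].
Proof.
have: kermx (col_mx x y)^T != 0.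
  rewrite -mxrank_eq0 mxrank_ker subn_eq0 -ltnNge.
  by rewrite (leq_ltn_trans (rank_leq_col _)).
case/rowV0Pn => v /sub_kermxP; rewrite tr_col_mx mul_mx_row.
rewrite -[0]row_mx0 => /eq_row_mx[vx vy] v0; exists v; split=> //.
  by move/rowP/(_ 0): vx; rewrite !mxE => <-; apply: eq_bigr => i _; rewrite mxE.
by move/rowP/(_ 0): vy; rewrite !mxE => <-; apply: eq_bigr => i _; rewrite mxE.
Qed.

(** If p x q = x with x <> 0 and q a unit, then p is the conjugate by x of the
    inverse of q, and both conjugations preserve the real part. *)
Lemma re_eq_of_fixed p q x : x != 0 -> qnorm q = 1 ->
  qmul (qmul p x) q = x -> p 0 0 = q 0 0.
Proof.
move=> x0 nq fixx; have nx : qnorm x != 0 by rewrite qnorm_eq0.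
have px : qmul p x = qmul x (qconj q).
  by rewrite -[in RHS]fixx -qmulA qmulxC nq scale1r qmul1r.
have : qmul (qmul p x) (qconj x) 0 0 = qmul (qconj x) (qmul p x) 0 0.
  exact: re_qmulC.
rewrite {2}px -qmulA qmulxC qmulA qmulCx qmulZl qmulZr qmul1l qmul1r !mxE /=.
exact: mulfI.
Qed.

Lemma sandwich_linear p q : linear (fun x => qmul (qmul p x) q).
Proof. by move=> k x y; rewrite qmulDr qmulDl qmulZr qmulZl. Qed.

Lemma id_simple : simple_rotation (fun x : quaternion R => x).
Proof.
exists 0, qone, (quat 0 1 0 0); split.
  by split; rewrite qdotE !mxE /=; ring.
by split=> //; rewrite cos0 sin0 ?oppr0 scale1r scale0r ?addr0 ?add0r.
Qed.

(** With p = cos theta + sin theta n for a unit pure n, and p t = t q, the map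
    sends t to p^2 t, and the plane of rotation is spanned by t and n t; the
    angle is 2 theta because p^2 = cos (2 theta) + sin (2 theta) n. *)
Lemma sandwich_simple p q : qnorm p = 1 -> qnorm q = 1 -> p 0 0 = q 0 0 ->
  simple_rotation (fun x => qmul (qmul p x) q).
Proof.
move=> np nq re_pq.
have [t nt pt] := intertwiner re_pq (etrans np (esym nq)).
set c := p 0 0; set theta := acos c; set s := sin theta.
have cosE : cos theta = c by apply: acosK; rewrite in_itv /= unit_re_le1.
have s2E : s ^+ 2 = 1 - c ^+ 2.
  by have := cos2Dsin2 theta; rewrite cosE -/s; lra.
have [s0|s0] := eqVneq s 0.
  (* Here p = q = 1 or p = q = -1. *)
  have c2 : c ^+ 2 = 1 by move: s2E; rewrite s0; lra.
  have -> : (fun x => qmul (qmul p x) q) = id; last exact: id_simple.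
  apply/funext => x; rewrite (unit_real np c2) (unit_real nq) -re_pq //.
  by rewrite qmulZl qmulZr qmul1l qmul1r scalerA -expr2 c2 scale1r.
(* This is n t, with n = s^-1 (p - c) the normalized vector part of p. *)
pose e2 := s^-1 *: (qmul p t - c *: t).
have e2E : e2 = qmul (s^-1 *: (p - c *: qone)) t.
  by rewrite qmulZl qmulDl -[- (c *: qone)]scaleNr qmulZl qmul1l scaleNr.
have ne2 : qnorm e2 = 1.
  rewrite e2E qnormM nt mulr1 qnormE !mxE /=.
  apply: (mulfI (expf_neq0 2 s0)); rewrite !exprMn exprVn -!mulrDr.
  by rewrite mulrA divff ?expf_neq0 // -/c; move: np; rewrite qnormE -/c; lra.
have qdotxx x : qdot x x = qnorm x by rewrite qdotE qnormE; ring.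
(* As p^2 = 2 c p - 1, left multiplication by p acts on (t, e2) as the rotation
   through theta; right multiplication by q does the same, since p and q act
   alike on t and hence on e2. *)
have ppt : qmul p (qmul p t) = (2 * c) *: qmul p t - t.
  by rewrite qmulA qmulpp np scale1r qmulDl qmulZl -scaleN1r qmulZl qmul1l scaleN1r.
exists (theta *+ 2), t, e2; split.
  split; rewrite ?qdotxx //.
  rewrite qdot_re e2E qconjM qmulA qmulxC nt scale1r qmul1l !mxE /= -/c; ring.
rewrite cos_mulr2n sin_mulr2n cosE -/s.
have pe2 : qmul p t = c *: t + s *: e2.
  by rewrite /e2 scalerA divff // scale1r addrC subrK.
have pe3 : qmul p e2 = c *: e2 - s *: t.
  apply/rowP => i; rewrite {1}/e2 qmulZr qmulDr ppt -scaleNr qmulZr /e2.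
  apply: (mulfI s0); move: (qmul p t) => r; rewrite !mxE.
  rewrite [in RHS]mulrBr !mulrA [s * c]mulrC -[_ * s * _]mulrA divff // mulr1.
  by rewrite -expr2 s2E; ring.
have hE v : qmul v q = qmul p v -> qmul (qmul p v) q = qmul p (qmul p v).
  by move=> vq; rewrite -qmulA vq.
have qe2 : qmul e2 q = qmul p e2.
  rewrite /e2 -!scaleNr qmulZl qmulZr qmulDl qmulDr qmulZl qmulZr.
  by rewrite (hE _ (esym pt)) -pt.
clearbody e2.
split=> [|||x xt xe2]; first exact: sandwich_linear.
- rewrite (hE _ (esym pt)) pe2 qmulDr !qmulZr pe2 pe3.
  apply/rowP => i; rewrite !mxE; ring: s2E.
- rewrite (hE _ qe2) pe3 -scaleNr qmulDr !qmulZr pe2 pe3.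
  apply/rowP => i; rewrite !mxE; ring: s2E.
(* For x orthogonal to t and e2, the quaternion x t^- is pure and orthogonal
   to the vector part of p. *)
have xw : x = qmul (qmul x (qconj t)) t.
  by rewrite -qmulA qmulCx nt scale1r qmul1r.
have w0 : qmul x (qconj t) 0 0 = 0 by rewrite -qdot_re.
have wp : qmul (qmul x (qconj t)) (qconj p) 0 0 = 0.
  rewrite -qmulA -qconjM -qdot_re pe2.
  have -> : qdot x (c *: t + s *: e2) = c * qdot x t + s * qdot x e2.
    by rewrite !qdotE !mxE; ring.
  by rewrite xt xe2 !mulr0 addr0.
rewrite [in LHS]xw qmulA (qmul_pure_perp w0 wp) -qmulA -pt.
by rewrite qmulA -[qmul (qmul _ (qconj p)) p]qmulA qmulCx np scale1r qmul1r.
Qed.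

Lemma sandwich_simpleP p q : qnorm p = 1 -> qnorm q = 1 ->
  simple_rotation (fun x => qmul (qmul p x) q) <-> p 0 0 = q 0 0.
Proof.
move=> np nq; split=> [[alpha [e1 [e2 [_ [_ _ _ fixed]]]]]|]; last first.
  exact: sandwich_simple.
have [v [v0 ve1 ve2]] := exists_orthogonal e1 e2.
exact: re_eq_of_fixed v0 nq (fixed v ve1 ve2).
Qed.

(** * Real parts of products of four normals *)

(** By cyclicity of the real part, the left-hand side is the difference of
    S(y^- z u^- w) and S(y^- w u^- z).  It is alternating in (y, z, u, w), and its
    value 2 at (1, i, j, k) gives the factor. *)
Lemma re_sub_det y z u w :
  qmul (qmul (qconj y) z) (qmul (qconj u) w) 0 0
  - qmul (qmul w (qconj u)) (qmul z (qconj y)) 0 0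
  = 2 * \det (\matrix_(i < 4) [:: y; z; u; w]`_i).
Proof.
pose f (i j : nat) : R := [:: y; z; u; w]`_i 0 (inord j).
have -> : \matrix_(i < 4) [:: y; z; u; w]`_i = \matrix_(i < 4, j < 4) f i j.
  by apply/matrixP => i j; rewrite !mxE /f inord_val.
have i0 : inord 0 = 0 :> 'I_4 by apply: val_inj; rewrite /= inordK.
have i1 : inord 1 = 1 :> 'I_4 by apply: val_inj; rewrite /= inordK.
have i2 : inord 2 = 2 :> 'I_4 by apply: val_inj; rewrite /= inordK.
have i3 : inord 3 = 3 :> 'I_4 by apply: val_inj; rewrite /= inordK.
rewrite det_quad /f /= i0 i1 i2 i3 !mxE /=.
ring.
Qed.

End QuaternionAlgebra.

(** * The composition of two simple rotations *)

Theorem theorem1 (R : realType) (f g : quaternion R -> quaternion R)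
    (a b c d y z u w : quaternion R)
    (fE : forall x, f x = qmul (qmul a x) b)
    (gE : forall x, g x = qmul (qmul c x) d)
    (f_simple : simple_rotation f)
    (g_simple : simple_rotation g)
    (y_unit : qnorm y = 1) (z_unit : qnorm z = 1)
    (u_unit : qnorm u = 1) (w_unit : qnorm w = 1)
    (f_refl : forall x, f x = qrefl z (qrefl y x))
    (aE : a = qmul z (qconj y)) (bE : b = qmul (qconj y) z)
    (g_refl : forall x, g x = qrefl w (qrefl u x))
    (cE : c = qmul w (qconj u)) (dE : d = qmul (qconj u) w) :
  simple_rotation (fun x => g (f x)) <-> ~~ free [:: y; z; u; w].
Proof.
have -> : (fun x => g (f x)) = (fun x => qmul (qmul (qmul c a) x) (qmul b d)).
  by apply/funext => x; rewrite gE fE !qmulA.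
apply: (iff_trans (sandwich_simpleP _ _)).
- by rewrite cE aE !qnormM !qnorm_conj y_unit z_unit u_unit w_unit !mulr1.
- by rewrite bE dE !qnormM !qnorm_conj y_unit z_unit u_unit w_unit !mulr1.
rewrite (free_det [tuple y; z; u; w]) negbK aE bE cE dE.
have det2 := re_sub_det y z u w.
split=> [re_eq|/eqP det0].
  by move/eqP: det2; rewrite re_eq subrr eq_sym mulf_eq0 pnatr_eq0.
by apply/esym/eqP; rewrite -subr_eq0 det2 det0 mulr0.
Qed.
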